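(* For every $n\ge 15$ of the form $n=2^k-1$ there exist binary perfect (1-error-correcting) homogeneous codes of length $n$ that are not transitive.
   Context: A binary code $C\subseteq F^n$ containing $0^n$ is perfect if every $x\in F^n$ is at Hamming distance at most one from exactly one codeword. For $y\in C$, $STS(C,y)=\{\mathrm{supp}(x+y)\mid x\in C,\ d(x,y)=3\}$; $C$ is homogeneous if for every $y\in C$ there is $\pi\in S_n$ with $\pi(STS(C,y))=STS(C,0^n)$. $C$ is transitive if for every $y\in C$ there is a coordinate permutation $\pi\in S_n$ with $y+\pi(C)=C$ (equivalently, $\mathrm{Aut}(C)=\{(y,\pi)\mid y+\pi(C)=C\}$ has a subgroup acting transitively on $C$). *)

(* Defs.v *)
From mathcomp Require Import all_boot fingroup perm.
Set Implicit Arguments. Unset Strict Implicit. Unset Printing Implicit Defensive.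

Definition word (n : nat) := {ffun 'I_n -> bool}.

Definition zero_word (n : nat) : word n := [ffun _ => false].

Definition wadd n (x y : word n) : word n := [ffun i => x i (+) y i].

Definition supp n (x : word n) : {set 'I_n} := [set i | x i].

Definition hdist n (x y : word n) : nat := #|[set i | x i != y i]|.

(* coordinate permutation acting on words: (pi x)_(pi i) = x_i *)
Definition wperm n (pi : {perm 'I_n}) (x : word n) : word n :=
  [ffun i => x ((pi^-1)%g i)].

Definition cperm n (pi : {perm 'I_n}) (C : {set word n}) : {set word n} :=
  [set wperm pi x | x in C].

Definition perfect n (C : {set word n}) : Prop :=
  forall x : word n, #|[set c in C | hdist x c <= 1]| = 1.

Definition STS n (C : {set word n}) (y : word n) : {set {set 'I_n}} :=
  [set supp (wadd x y) | x in [set x in C | hdist x y == 3]].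

Definition sperm n (pi : {perm 'I_n}) (F : {set {set 'I_n}}) : {set {set 'I_n}} :=
  [set [set pi i | i in B] | B : {set 'I_n} in F].

Definition homogeneous n (C : {set word n}) : Prop :=
  forall y, y \in C -> exists pi : {perm 'I_n}, sperm pi (STS C y) = STS C (zero_word n).

Definition transitive_code n (C : {set word n}) : Prop :=
  forall y, y \in C -> exists pi : {perm 'I_n},
    [set wadd y x | x in cperm pi C] = C.

(* Main.v *)
Require Import Defs.
From mathcomp Require Import all_boot fingroup perm.
Set Implicit Arguments. Unset Strict Implicit. Unset Printing Implicit Defensive.

(** Vasil'ev's construction [{(x, x + c, |x| + lam c) | c in C}] turns a perfect code
  [C] of length [m] into one of length [2m + 1], for every Boolean function [lam] on [C].
  Length 15 is obtained from the Hamming code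
  [{(<a,i> + e)_i | a in F_2^3, e in F_2}] of length 7 and
  [lam = a1 (if e then a3 else a2)].  Translating [lam] by a codeword changes it, on the
  words of weight 3, by a linear functional and, if [e] is set, by the exchange
  of [a2] and [a3]; both are realised by coordinate permutations, whence homogeneity.

  Nontransitivity comes from a property of a codeword [y] which is invariant under the
  automorphisms of the code: the existence of three triples in [STS(C, y)] whose sum lies
  in [C + y] while no sum of two of them does.  It depends on [y], and both it and
  homogeneity are inherited by the construction with [lam = 0], which gives the larger
  lengths. *)

Lemma eqb_addr (a b c : bool) : (a (+) b == c) = (a == c (+) b).
Proof. by case: a b c => [] [] []. Qed.

(** * Binary words over an arbitrary finite set of coordinates *)

Section Words.
Variable I : finType.
Implicit Types (x y : {ffun I -> bool}) (C : pred {ffun I -> bool}).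

Definition zerow : {ffun I -> bool} := [ffun=> false].
Definition addw x y : {ffun I -> bool} := [ffun i => x i (+) y i].
Definition dotw x y : bool := \big[addb/false]_i (x i && y i).
Definition weight x : nat := \sum_i x i.
Definition flip (o : option I) x : {ffun I -> bool} :=
  [ffun i => x i (+) (o == Some i)].

(* The ball of radius one around [x] is [{flip o x | o : option I}]. *)
Definition perfectw C : Prop :=
  forall x, exists o, forall o', C (flip o' x) = (o' == o).

Lemma addwC x y : addw x y = addw y x.
Proof. by apply/ffunP=> i; rewrite !ffunE addbC. Qed.

Lemma addwK x y : addw (addw x y) y = x.
Proof. by apply/ffunP=> i; rewrite !ffunE addbK. Qed.

Lemma add0w x : addw zerow x = x.
Proof. by apply/ffunP=> i; rewrite !ffunE. Qed.

End Words.

Definition pullw (I J : finType) (f : J -> I) (x : {ffun I -> bool}) : {ffun J -> bool} :=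
  [ffun j => x (f j)].

Lemma pullw_add (I J : finType) (f : J -> I) x y :
  pullw f (addw x y) = addw (pullw f x) (pullw f y).
Proof. by apply/ffunP=> j; rewrite !ffunE. Qed.

Lemma pullwK (I J : finType) (f : J -> I) (g : I -> J) :
  cancel g f -> cancel (pullw f) (pullw g).
Proof. by move=> gK x; apply/ffunP=> i; rewrite !ffunE gK. Qed.

Lemma weight_pullw (I J : finType) (f : J -> I) x :
  bijective f -> weight (pullw f x) = weight x.
Proof.
move=> bij_f; rewrite /weight [RHS](reindex f) /=; last exact: onW_bij.
by apply: eq_bigr => j _; rewrite ffunE.
Qed.

(** * Homogeneity and the property that separates codewords *)

Section Invariants.
Variable I : finType.
Implicit Types (x y : {ffun I -> bool}) (C : pred {ffun I -> bool}).

(** For a perfect [C] containing zero only triples matter: words of weight 1 or 2 lie neither in [C]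
    nor in its translate by a codeword. *)
Definition homogeneousw C : Prop :=
  forall y, C y -> exists2 f : I -> I, injective f &
    forall t, weight t <= 3 -> C (addw t y) = C (pullw f t).

(* The bound 3 admits the zero word besides the triples, but no such [s], [t], [u] is zero;
   unlike an exact weight, it is preserved by folding. *)
Definition odd_triad C y : Prop :=
  exists s t u : {ffun I -> bool},
    [/\ weight s <= 3, weight t <= 3, weight u <= 3,
        [/\ C (addw s y), C (addw t y) & C (addw u y)] &
        [/\ ~~ C (addw (addw s t) y), ~~ C (addw (addw s u) y),
            ~~ C (addw (addw t u) y) & C (addw (addw (addw s t) u) y)]].

End Invariants.

(** Relabelling coordinates preserves weights and sums. This serves both the automorphisms of a code
    and the passage to ['I_n]. *)
Lemma odd_triad_iso (I J : finType) (C : pred {ffun I -> bool})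
    (D : pred {ffun J -> bool}) (f : J -> I) y z :
  bijective f -> (forall t, C (addw t y) = D (addw (pullw f t) z)) ->
  odd_triad C y <-> odd_triad D z.
Proof.
move=> bij_f eqCD; case: (bij_f) => g fK gK.
split=> -[s [t [u [ws wt wu [Cs Ct Cu] [Cst Csu Ctu Cstu]]]]].
  exists (pullw f s), (pullw f t), (pullw f u).
  by rewrite !weight_pullw // -!pullw_add -!eqCD.
have bij_g : bijective g by exists f.
exists (pullw g s), (pullw g t), (pullw g u).
by rewrite !weight_pullw // !eqCD !pullw_add !(pullwK fK).
Qed.

(** * Vasil'ev's construction *)

Section Vasilev.
Variables (I : finType).
Let J : finType := option (I + I)%type.
Implicit Types (C lam : pred {ffun I -> bool}) (h : {ffun I -> bool}) (w y : {ffun J -> bool}).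

(** Both [foldw] and [checkw] are linear; through them Vasil'ev's code is the preimage of the graph
    of [lam] over [C]. *)
Definition foldw w : {ffun I -> bool} :=
  [ffun i => w (Some (inl i)) (+) w (Some (inr i))].

Definition checkw w : bool :=
  w None (+) \big[addb/false]_i w (Some (inl i)).

(* With [w = (x, z, p)] this is Vasil'ev's code
   [{(x, x + c, |x| + lam c) | c in C}]. *)
Definition vasilev C lam : pred {ffun J -> bool} :=
  fun w => C (foldw w) && (checkw w == lam (foldw w)).

Lemma big_vasilev (R : Type) (idx : R) (op : Monoid.com_law idx) (F : J -> R) :
  \big[op/idx]_j F j =
  op (F None) (op (\big[op/idx]_i F (Some (inl i))) (\big[op/idx]_i F (Some (inr i)))).
Proof.
rewrite (bigD1 None) //=; congr (op _ _).
rewrite (reindex_omap Some id) /=; last by case.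
rewrite (eq_bigl xpredT) ?big_sumType // => i.
by rewrite eqxx.
Qed.

Lemma foldwD w y : foldw (addw w y) = addw (foldw w) (foldw y).
Proof. by apply/ffunP=> i; rewrite !ffunE addbACA. Qed.

Lemma checkwD w y : checkw (addw w y) = checkw w (+) checkw y.
Proof.
rewrite /checkw ffunE addbACA -big_split /=; congr (_ (+) _).
by apply: eq_bigr => i _; rewrite ffunE.
Qed.

Lemma foldw0 : foldw (zerow J) = zerow I.
Proof. by apply/ffunP=> i; rewrite !ffunE. Qed.

Lemma checkw0 : checkw (zerow J) = false.
Proof. by rewrite /checkw ffunE big1 // => i _; rewrite ffunE. Qed.

Lemma weight_foldw w : weight (foldw w) <= weight w.
Proof.
rewrite [leqRHS]big_vasilev /= -big_split /=.
apply: leq_trans (leq_addl _ _); apply: leq_sum => i _; rewrite ffunE.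
by do 2!case: (w _).
Qed.

(** Seen from [y], the code is again of Vasil'ev type, with [lam] translated and normalised to
    vanish at zero. *)
Lemma vasilev_add C lam w y : vasilev C lam y ->
  vasilev C lam (addw w y) =
  C (addw (foldw w) (foldw y)) &&
  (checkw w == lam (addw (foldw w) (foldw y)) (+) lam (foldw y)).
Proof.
case/andP=> _ /eqP ey; rewrite /vasilev foldwD checkwD ey.
by rewrite eqb_addr.
Qed.

Lemma vasilev_perfect C lam : perfectw C -> perfectw (vasilev C lam).
Proof.
move=> pC w; have [o ho] := pC (foldw w).
(* [proj] is the flip induced on the fold, [flips] the change of the check bit. Each value of [proj]
   is attained twice, once with each value of [flips], so exactly one flip meets both conditions. *)
pose proj (o' : option J) : option I :=
  if o' is Some (Some j) then Some (match j with inl i => i | inr i => i end) else None.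
pose flips (o' : option J) :=
  match o' with Some None | Some (Some (inl _)) => true | _ => false end.
have foldE o' : foldw (flip o' w) = flip (proj o') (foldw w).
  apply/ffunP=> i; rewrite !ffunE addbACA; congr (_ (+) _).
  by case: o' => [[[j|j]|]|] //=; rewrite ?addbF.
have checkE o' : checkw (flip o' w) = checkw w (+) flips o'.
  rewrite /checkw ffunE; under eq_bigr do rewrite ffunE.
  rewrite big_split /= addbACA; congr (_ (+) _).
  case: o' => [[[j|j]|]|] /=; last 3 first; try by rewrite big1.
  rewrite (bigD1 j) //= big1 ?eqxx //.
  by move=> i /negPf; rewrite eq_sym => neq; apply: contraFF neq => /eqP[->].
pose d := checkw w (+) lam (flip o (foldw w)).
exists (if o is Some i then Some (Some (if d then inl i else inr i))
        else if d then Some None else None).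
move=> o'; rewrite /vasilev foldE ho checkE.
case: eqP => [e|ne] /=; last first.
  symmetry; apply: contra_notF ne => /eqP->; by clearbody d; case: o {ho} => [i|]; case: d.
rewrite e addbC eqb_addr addbC -/d.
clearbody d; case: o e {ho} => [i|]; case: o' => [[[j|j]|]|] //=.
- by case=> ->; case: d; rewrite ?eqxx.
- by case=> ->; case: d; rewrite ?eqxx.
- by case: d.
- by case: d.
Qed.

Definition twistable C lam c : Prop :=
  exists (f : I -> I) (a : {ffun I -> bool}), injective f /\
    forall h, weight h <= 3 ->
      C (addw h c) = C (pullw f h) /\
      (C (pullw f h) ->
       lam (addw h c) (+) lam c = lam (pullw f h) (+) dotw a (pullw f h)).

(* The functional [dotw a] is absorbed by exchanging the two copies of each
   coordinate [i] such that [a i]. *)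
Lemma vasilev_homogeneous C lam :
  (forall c, C c -> twistable C lam c) -> homogeneousw (vasilev C lam).
Proof.
move=> tw y Vy; have [Cy _] := andP Vy.
have [f [a [injf hf]]] := tw _ Cy.
pose F (j : J) : J := match j with
  | None => None
  | Some (inl i) => Some (if a i then inr (f i) else inl (f i))
  | Some (inr i) => Some (if a i then inl (f i) else inr (f i)) end.
exists F => [|t wt].
  move=> [[i|i]|] [[j|j]|] //=; case: ifP => ai; case: ifP => aj // [] /injf e;
    by move: ai aj; rewrite e => ->.
have [eC el] := hf _ (leq_trans (weight_foldw t) wt).
have foldF : foldw (pullw F t) = pullw f (foldw t).
  by apply/ffunP=> i; rewrite !ffunE /=; case: ifP => // _; rewrite addbC.
have checkF : checkw (pullw F t) = checkw t (+) dotw a (pullw f (foldw t)).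
  rewrite /checkw ffunE /= -addbA; congr (_ (+) _).
  rewrite [X in _ = X (+) _](reindex f) /=; last exact/onW_bij/injF_bij.
  rewrite -big_split /=; apply: eq_bigr => i _; rewrite !ffunE /=.
  by case: (a i); do 2!case: (t _).
rewrite vasilev_add // eC /vasilev foldF; have [CC|//] := boolP (C (pullw f _)).
by rewrite el // checkF eqb_addr.
Qed.

(* Taking [o = Some i] with [h i] sets the check bit without changing the weight. *)
Definition liftw (o : option I) (h : {ffun I -> bool}) : {ffun J -> bool} :=
  [ffun j => match j with
   | None => false
   | Some (inl i) => o == Some i
   | Some (inr i) => h i (+) (o == Some i) end].

Lemma foldw_lift o h : foldw (liftw o h) = h.
Proof. by apply/ffunP=> i; rewrite !ffunE addbC addbK. Qed.

Lemma checkw_lift o h : checkw (liftw o h) = (o != None).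
Proof.
rewrite /checkw ffunE /=; under eq_bigr do rewrite ffunE /=.
case: o => [i|] /=; last by rewrite big1.
rewrite (bigD1 i) //= eqxx big1 // => k /negPf nk.
by apply: contraFF nk => /eqP[->].
Qed.

Lemma weight_lift o h : (forall i, o = Some i -> h i) -> weight (liftw o h) = weight h.
Proof.
move=> ho; rewrite [LHS]big_vasilev /= ffunE add0n -big_split /=.
apply: eq_bigr => i _; rewrite !ffunE.
by case: eqP => [/ho ->|_] //; rewrite addbF.
Qed.

Lemma vasilev0_add C w y : vasilev C pred0 y ->
  checkw w = false -> vasilev C pred0 (addw w y) = C (addw (foldw w) (foldw y)).
Proof. by move=> Vy ew; rewrite vasilev_add // ew eqxx andbT. Qed.

(** With [lam = 0] the check bits of [s], [t], [u] vanish, hence those of their sums, and the folds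
    alone decide membership. Conversely, [liftw None] keeps weights and has check bit zero. *)
Lemma odd_triad_vasilev0 C y : vasilev C pred0 y ->
  odd_triad (vasilev C pred0) y <-> odd_triad C (foldw y).
Proof.
move=> Vy; split=> -[s [t [u [ws wt wu [Cs Ct Cu] [Cst Csu Ctu Cstu]]]]].
  exists (foldw s), (foldw t), (foldw u).
  have es : checkw s = false by move: Cs; rewrite vasilev_add // => /andP[_ /eqP].
  have et : checkw t = false by move: Ct; rewrite vasilev_add // => /andP[_ /eqP].
  have eu : checkw u = false by move: Cu; rewrite vasilev_add // => /andP[_ /eqP].
  rewrite -(foldwD s t) -(foldwD s u) -(foldwD t u) -(foldwD (addw s t) u).
  rewrite -!vasilev0_add // ?checkwD ?es ?et ?eu //.
  by split; [apply: leq_trans ws|apply: leq_trans wt|apply: leq_trans wu|..];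
    rewrite ?weight_foldw.
exists (liftw None s), (liftw None t), (liftw None u).
by rewrite !weight_lift // !vasilev0_add ?checkwD ?checkw_lift // !foldwD !foldw_lift.
Qed.

End Vasilev.

(** * The Hamming code of length 7 and the function [twist] on it *)

Section Hamming.

Local Notation o k := (@Ordinal 7 k isT).

Lemma big_ord7 (R : Type) (idx : R) (op : Monoid.law idx) (F : 'I_7 -> R) :
  \big[op/idx]_i F i =
  op (F (o 0)) (op (F (o 1)) (op (F (o 2)) (op (F (o 3)) (op (F (o 4))
    (op (F (o 5)) (F (o 6))))))).
Proof.
rewrite !big_ord_recl big_ord0 Monoid.mulm1.
by do !congr (op _ _); congr F; apply: val_inj.
Qed.

Lemma ord7P (P : 'I_7 -> Prop) :
  P (o 0) -> P (o 1) -> P (o 2) -> P (o 3) -> P (o 4) -> P (o 5) -> P (o 6) ->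
  forall i, P i.
Proof.
move=> P0 P1 P2 P3 P4 P5 P6 [m lt_m].
by case: m lt_m => [|[|[|[|[|[|[|//]]]]]]] lt_m; rewrite (bool_irrelevance lt_m isT).
Qed.

(* Coordinate [i] stands for the nonzero vector of F_2^3 whose binary expansion is [i.+1]. *)
Definition digit (j : nat) (i : 'I_7) : bool := odd (i.+1 %/ 2 ^ j).

Definition syndrome (j : nat) (x : {ffun 'I_7 -> bool}) : bool :=
  \big[addb/false]_i (digit j i && x i).

Definition hamming : pred {ffun 'I_7 -> bool} :=
  fun x => ~~ [|| syndrome 0 x, syndrome 1 x | syndrome 2 x].

Definition hamw (a1 a2 a3 e : bool) : {ffun 'I_7 -> bool} :=
  [ffun i => (digit 0 i && a1) (+) (digit 1 i && a2) (+) (digit 2 i && a3) (+) e].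

(* [a1 && (if e then a3 else a2)] on [hamw a1 a2 a3 e]. *)
Definition twist : pred {ffun 'I_7 -> bool} := fun x =>
  (x (o 1) (+) x (o 2)) &&
  (if x (o 0) (+) x (o 1) (+) x (o 2) then x (o 0) (+) x (o 4) else x (o 0) (+) x (o 2)).

Lemma syndromeD j x y : syndrome j (addw x y) = syndrome j x (+) syndrome j y.
Proof.
by rewrite -big_split; apply: eq_bigr => i _; rewrite ffunE andb_addr.
Qed.

Lemma syndrome_flip j p x :
  syndrome j (flip p x) = syndrome j x (+) (if p is Some i then digit j i else false).
Proof.
rewrite /syndrome (eq_bigr (fun i => (digit j i && x i) (+) (digit j i && (p == Some i)))).
  rewrite big_split /=; congr (_ (+) _).
  case: p => [i|]; last by rewrite big1 // => i; rewrite andbF.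
  rewrite (bigD1 i) //= eqxx andbT big1 ?addbF // => k /negPf nk.
  by case: eqP => [[e]|]; [rewrite e eqxx in nk | rewrite andbF].
by move=> i _; rewrite ffunE andb_addr.
Qed.

Lemma hamming_perfect : perfectw hamming.
Proof.
move=> x.
(* The syndrome, read in binary, is one more than the coordinate to flip, or zero if there is
   none. *)
exists (match syndrome 2 x, syndrome 1 x, syndrome 0 x with
  | false, false, false => None
  | false, false, true => Some (o 0) | false, true, false => Some (o 1)
  | false, true, true => Some (o 2) | true, false, false => Some (o 3)
  | true, false, true => Some (o 4) | true, true, false => Some (o 5)
  | true, true, true => Some (o 6) end).
move=> p; rewrite /hamming !syndrome_flip; move: (syndrome _ x) (syndrome _ x) (syndrome _ x).
by case: p => [i|]; [elim/ord7P: i|]; do 3!case.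
Qed.

Lemma hamming_hamw a1 a2 a3 e : hamming (hamw a1 a2 a3 e).
Proof.
rewrite /hamming /syndrome !big_ord7 !ffunE.
by case: a1 a2 a3 e => [] [] [] [].
Qed.

Lemma hammingP x : hamming x -> exists a1 a2 a3 e, x = hamw a1 a2 a3 e.
Proof.
(* Coordinates 0, 1, 2, 4 carry [a1 + e], [a2 + e], [a1 + a2 + e], [a1 + a3 + e]. *)
move=> Hx; exists (x (o 1) (+) x (o 2)), (x (o 0) (+) x (o 2)), (x (o 0) (+) x (o 4)),
  (x (o 0) (+) x (o 1) (+) x (o 2)).
move: Hx; rewrite /hamming /syndrome !big_ord7 => Hx; apply/ffunP; apply: ord7P;
  rewrite ffunE; move: Hx;
  by move: (x (o 0)) (x (o 1)) (x (o 2)) (x (o 3)) (x (o 4)) (x (o 5)) (x (o 6)); do 7!case.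
Qed.

Lemma hammingD x y : hamming y -> hamming (addw x y) = hamming x.
Proof.
rewrite /hamming !syndromeD !negb_or => /and3P[/negPf-> /negPf-> /negPf->].
by rewrite !addbF.
Qed.

Lemma hamwD a1 a2 a3 e b1 b2 b3 e' :
  addw (hamw a1 a2 a3 e) (hamw b1 b2 b3 e') =
  hamw (a1 (+) b1) (a2 (+) b2) (a3 (+) b3) (e (+) e').
Proof.
apply/ffunP=> i; rewrite !ffunE; move: (digit 0 i) (digit 1 i) (digit 2 i).
by case: a1 a2 a3 e b1 b2 b3 e' => [] [] [] [] [] [] [] [] [] [] [].
Qed.

Lemma twist_hamw a1 a2 a3 e : twist (hamw a1 a2 a3 e) = a1 && (if e then a3 else a2).
Proof. by rewrite /twist !ffunE; case: a1 a2 a3 e => [] [] [] []. Qed.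

(** A nonzero linear functional on F_2^3 takes the value 1 at four points, so [e = false] forces
    weight 4 or 0. *)
Lemma weight_hamw a1 a2 a3 e :
  weight (hamw a1 a2 a3 e) <= 3 -> e || ~~ [|| a1, a2 | a3].
Proof.
by rewrite /weight big_ord7 !ffunE; case: a1 a2 a3 e => [] [] [] [].
Qed.

Lemma hamw0 : hamw false false false false = zerow _.
Proof. by apply/ffunP=> i; rewrite !ffunE !andbF. Qed.

(* Exchange of the last two of the three digits of [i.+1]. *)
Definition swap_digits (i : 'I_7) : 'I_7 :=
  match val i with 1 => o 3 | 2 => o 4 | 3 => o 1 | 4 => o 2 | _ => i end.

Lemma swap_digitsK : involutive swap_digits.
Proof. by apply: ord7P. Qed.

Lemma pullw_swap a1 a2 a3 e : pullw swap_digits (hamw a1 a2 a3 e) = hamw a1 a3 a2 e.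
Proof.
by apply/ffunP; apply: ord7P; rewrite !ffunE; case: a1 a2 a3 e => [] [] [] [].
Qed.

Lemma hamming_swap x : hamming (pullw swap_digits x) = hamming x.
Proof.
rewrite /hamming /syndrome !big_ord7 !ffunE.
rewrite /swap_digits /=.
by move: (x (o 0)) (x (o 1)) (x (o 2)) (x (o 3)) (x (o 4)) (x (o 5)) (x (o 6)); do 7!case.
Qed.

(** Coordinates 0, 1, 3 are the unit vectors; 0, 1, 2 form a line of the Fano plane, over which a
    codeword sums to [e]. *)
Definition slope (c1 c2 c3 k : bool) : {ffun 'I_7 -> bool} :=
  [ffun i => match val i with
   | 0 => c1 (+) k | 1 => c2 (+) k | 2 => k | 3 => c3 | _ => false end].

(* A word of weight at most 3 is zero or has [e = true], so [k] adjusts a constant. *)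
Lemma dotw_slope c1 c2 c3 k a1 a2 a3 e :
  dotw (slope c1 c2 c3 k) (hamw a1 a2 a3 e) =
  (c1 && a1) (+) (c2 && a2) (+) (c3 && a3) (+) ((c1 (+) c2 (+) c3 (+) k) && e).
Proof.
rewrite /dotw big_ord7 !ffunE.
by case: c1 c2 c3 k a1 a2 a3 e => [] [] [] [] [] [] [] [].
Qed.

Lemma hamming_twistable c : hamming c -> twistable hamming twist c.
Proof.
move=> Hc; have [c1 [c2 [c3 [e cE]]]] := hammingP Hc.
have twE h : twist (addw h c) (+) twist c =
    twist (addw h (hamw c1 c2 c3 e)) (+) (c1 && (if e then c3 else c2)).
  by rewrite cE twist_hamw.
case: e twE {cE} => twE.
  (* A nonzero [h] has [e = true], so [h + c] has [e = false] and [twist] changes by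
     [(a1 + c1)(a2 + c2) + c1 c3]. Its quadratic part [a1 a2] is the twist of the swapped [h];
     [slope] supplies the rest, with constant term [c1 (c2 + c3)]. *)
  exists swap_digits, (slope c2 false c1 ((c1 && (c2 (+) c3)) (+) c1 (+) c2)).
  split=> [|h wh]; first exact: inv_inj swap_digitsK.
  rewrite hammingD // hamming_swap; split=> // Hh; rewrite twE.
  have [a1 [a2 [a3 [e hE]]]] := hammingP Hh; move: wh; rewrite hE => /weight_hamw.
  rewrite pullw_swap hamwD !twist_hamw dotw_slope.
  by case: c1 c2 c3 a1 a2 a3 e {hE} twE => [] [] [] [] [] [] [].
(* Here [h + c] keeps [e = true] and the change is [(a1 + c1)(a3 + c3) + c1 c2], with quadratic part
   the twist of [h] itself. *)
exists id, (slope c3 false c1 ((c1 && (c2 (+) c3)) (+) c1 (+) c3)).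
split=> // h wh; have -> : pullw id h = h by apply/ffunP=> i; rewrite ffunE.
rewrite hammingD //; split=> // Hh; rewrite twE.
have [a1 [a2 [a3 [e hE]]]] := hammingP Hh; move: wh; rewrite hE => /weight_hamw.
rewrite hamwD !twist_hamw dotw_slope.
by case: c1 c2 c3 a1 a2 a3 e {hE} twE => [] [] [] [] [] [] [].
Qed.

End Hamming.

(** * The code of length 15 and its repeated doubling *)

Definition good_code (I : finType) (C : pred {ffun I -> bool}) : Prop :=
  [/\ C (zerow I), perfectw C, homogeneousw C, ~ odd_triad C (zerow I)
    & exists2 y, C y & odd_triad C y].

Definition code15 := vasilev hamming twist.

Lemma hamming0 : hamming (zerow _).
Proof. by rewrite -hamw0 hamming_hamw. Qed.

Lemma twist0 : twist (zerow _) = false.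
Proof. by rewrite -hamw0 twist_hamw. Qed.

Lemma code15_0 : code15 (zerow _).
Proof. by rewrite /code15 /vasilev foldw0 checkw0 hamming0 twist0. Qed.

Lemma code15_word w : weight w <= 3 -> code15 w ->
  exists a1 a2 a3 e, [/\ foldw w = hamw a1 a2 a3 e,
    checkw w = a1 && (if e then a3 else a2) & e || ~~ [|| a1, a2 | a3]].
Proof.
move=> ww /andP[/hammingP[a1 [a2 [a3 [e fE]]]]]; rewrite fE twist_hamw => /eqP cE.
exists a1, a2, a3, e; split=> //; apply: weight_hamw.
by rewrite -fE (leq_trans (weight_foldw w)).
Qed.

Lemma code15_no_triad : ~ odd_triad code15 (zerow _).
Proof.
move=> [s [t [u [ws wt wu [Cs Ct Cu]]]]].
rewrite ![addw _ (zerow _)]addwC !add0w in Cs Ct Cu *.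
have [s1 [s2 [s3 [es [fs cs hs]]]]] := code15_word ws Cs.
have [t1 [t2 [t3 [et [ft ct ht]]]]] := code15_word wt Ct.
have [u1 [u2 [u3 [eu [fu cu hu]]]]] := code15_word wu Cu.
rewrite /code15 /vasilev !foldwD !checkwD fs ft fu cs ct cu !hamwD !twist_hamw !hamming_hamw /=.
clear -hs ht hu.
(* A member with [e = false] has zero fold and zero check bit, so its sum with another member stays
   in the code. *)
case: es hs => [_|]; last by case: s1 s2 s3 => [] [] [] //= _; case: (_ && _); case.
case: et ht => [_|]; last by case: t1 t2 t3 => [] [] [] //= _; rewrite addbF /= addbF eqxx; case.
case: eu hu => [_|]; last by case: u1 u2 u3 => [] [] [] //= _; rewrite ?addbF ?eqxx => -[].
(* If [s1 = t1], then [s + t] outside the code forces [s1 = t1 = 1] and [s3 <> t3]. Two of [s1],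
   [t1], [u1] agree, but not all three, as three bits are not pairwise distinct. So the triple sum
   has first parameter 0, hence twist 0, but check bit 1. *)
by case: s1 s2 s3 t1 t2 t3 u1 u2 u3 => [] [] [] [] [] [] [] [] [] [].
Qed.

Lemma code15_triad : exists2 y, code15 y & odd_triad code15 y.
Proof.
pose y := liftw None (hamw true false false false).
have Vy : code15 y by rewrite /code15 /vasilev foldw_lift checkw_lift hamming_hamw twist_hamw.
exists y => //.
(* In the translate by [y] the check bit must be [(a1 + 1) a3] if [e] holds and [(a1 + 1) a2]
   otherwise. Only the third word needs check bit 1, set through coordinate 0 of its support. *)
exists (liftw None (hamw true false false true)), (liftw None (hamw true true false true)),
  (liftw (Some ord0) (hamw false false true true)).
have w3 a1 a2 a3 : [|| a1, a2 | a3] -> weight (hamw a1 a2 a3 true) <= 3.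
  by rewrite /weight big_ord7 !ffunE; case: a1 a2 a3 => [] [] [].
rewrite /code15 !vasilev_add // !foldwD !checkwD !foldw_lift !checkw_lift !hamwD.
rewrite !twist_hamw !hamming_hamw; split=> //; rewrite weight_lift ?w3 //.
by move=> i [<-]; rewrite ffunE.
Qed.

Lemma good_code15 : good_code code15.
Proof.
split; [exact: code15_0| | |exact: code15_no_triad|exact: code15_triad].
  exact: vasilev_perfect hamming_perfect.
exact/vasilev_homogeneous/hamming_twistable.
Qed.

Lemma good_code_double (I : finType) (C : pred {ffun I -> bool}) :
  good_code C -> good_code (vasilev C pred0).
Proof.
case=> C0 pC hC noC [y Cy triad_y].
have V0 : vasilev C pred0 (zerow _) by rewrite /vasilev foldw0 checkw0 C0.
split=> //; first exact: vasilev_perfect.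
- apply: vasilev_homogeneous => c /hC[f injf hf]; exists f, (zerow _).
  split=> // h /hf->; split=> // _ /=.
  by rewrite /dotw big1 // => i _; rewrite ffunE.
- by move=> /(odd_triad_vasilev0 V0); rewrite foldw0.
have Vy : vasilev C pred0 (liftw None y) by rewrite /vasilev foldw_lift checkw_lift Cy.
by exists (liftw None y) => //; apply/odd_triad_vasilev0; rewrite // foldw_lift.
Qed.

Lemma good_code_exists k : 4 <= k ->
  exists (I : finType) (C : pred {ffun I -> bool}), #|I| = (2 ^ k).-1 /\ good_code C.
Proof.
elim: k => // k IHk; rewrite leq_eqVlt => /orP[/eqP<-|/IHk[I [C [cardI gC]]]].
  exists (option ('I_7 + 'I_7)%type), code15.
  by split; [rewrite card_option card_sum card_ord|exact: good_code15].
exists (option (I + I)%type), (vasilev C pred0); split; last exact: good_code_double.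
rewrite card_option card_sum cardI expnS mul2n -addnn.
by rewrite -{3 4}(prednK (expn_gt0 2 k : 0 < 2 ^ k)) addnS.
Qed.

(** * Passage to codes with coordinates in ['I_n] *)

Section Transfer.
Variables (n : nat) (I : finType) (C : pred {ffun I -> bool}) (f : I -> 'I_n) (g : 'I_n -> I).
Hypotheses (fK : cancel f g) (gK : cancel g f).

Definition codeset : {set word n} := [set x | C (pullw f x)].

Lemma weight_supp (x : word n) : #|supp x| = weight x.
Proof.
by rewrite -sum1_card big_mkcond; apply: eq_bigr => i _; rewrite inE; case: (x i).
Qed.

Lemma hdistE (x y : word n) : hdist x y = weight (wadd x y).
Proof.
rewrite -weight_supp; apply: eq_card => i.
by rewrite !inE ffunE; case: (x i) (y i) => [] [].
Qed.

Lemma waddK (x y : word n) : wadd (wadd x y) y = x.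
Proof. exact: addwK. Qed.

Lemma waddKl (x y : word n) : wadd y (wadd y x) = x.
Proof. by apply/ffunP=> i; rewrite !ffunE addKb. Qed.

Lemma wadd0 (x : word n) : wadd x (zero_word n) = x.
Proof. by apply/ffunP=> i; rewrite !ffunE addbF. Qed.

Lemma weight_le1 (x : word n) :
  reflect (exists o, x = flip o (zerow _)) (weight x <= 1).
Proof.
apply: (iffP idP) => [|[o ->]].
  case: (set_0Vmem (supp x)) => [s0 _|[j]].
    by exists None; apply/ffunP=> i; move/setP/(_ i): s0; rewrite !inE !ffunE.
  rewrite inE => xj; rewrite /weight (bigD1 j) //= xj ltnS leqn0 sum_nat_eq0 => /forall_inP x0.
  exists (Some j); apply/ffunP=> i; rewrite !ffunE /=.
  have [<-|ne] := eqVneq j i; first by rewrite xj eqxx.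
  have := x0 i; rewrite eq_sym ne => /(_ isT).
  by case: (x i) => // _; apply/esym/eqP => -[e]; rewrite e eqxx in ne.
rewrite /weight; case: o => [j|]; last by rewrite big1 // => i _; rewrite !ffunE.
rewrite (bigD1 j) //= big1 => [|i /negPf ne]; first by case: (_ j).
by rewrite !ffunE; apply/eqP; rewrite eqb0; apply: contraFN ne => /eqP[->].
Qed.

Lemma codeset_perfect : perfectw C -> perfect codeset.
Proof.
move=> pC x; have [o ho] := pC (pullw f x).
have memE o' : (flip o' x \in codeset) = (o' == omap f o).
  rewrite inE; have -> : pullw f (flip o' x) = flip (omap g o') (pullw f x).
    apply/ffunP=> i; rewrite !ffunE; congr (_ (+) _); case: o' => //= j.
    by apply/eqP/eqP => -[]; [move->; rewrite fK | move<-; rewrite gK].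
  rewrite ho; case: o' o {ho} => [j|] [i|] //=.
  by apply/eqP/eqP => -[]; [move<-; rewrite gK | move->; rewrite fK].
apply/eqP/cards1P; exists (flip (omap f o) x); apply/setP=> c; rewrite in_set1 inE hdistE.
apply/andP/eqP => [[Cc /weight_le1[o' xc]]|->].
  have cE : c = flip o' x.
    by apply/ffunP=> i; move/ffunP/(_ i): xc; rewrite !ffunE /= => <-; rewrite addKb.
  by move: Cc; rewrite cE memE => /eqP->.
rewrite memE; split=> //; apply/weight_le1; exists (omap f o).
by apply/ffunP=> i; rewrite !ffunE addKb.
Qed.

Lemma codeset_homogeneous : homogeneousw C -> homogeneous codeset.
Proof.
move=> hC y; rewrite inE => /hC[p injp hp].
have inj_q : injective (fun i => f (p (g i))).
  by apply: inj_comp (can_inj fK) _; apply: inj_comp injp (can_inj gK).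
(* [wperm] moves supports forward whereas [pullw] pulls them back, whence the inverse. *)
pose r := perm inj_q; exists (r^-1)%g.
have CE (t : word n) : weight t = 3 -> (wadd t y \in codeset) = (wperm r^-1 t \in codeset).
  move=> wt; have bij_f : bijective f by exists g.
  rewrite !inE (pullw_add f t y) hp ?weight_pullw ?wt //.
  by congr (C _); apply/ffunP=> i; rewrite !ffunE invgK permE fK.
have suppE (t : word n) : supp (wperm r^-1 t) = [set r^-1%g i | i in supp t].
  apply/setP=> i; rewrite !inE ffunE invgK; apply/idP/imsetP => [ti|[j]].
    by exists (r i); rewrite ?inE ?permK.
  by rewrite inE => tj ->; rewrite permKV.
have weightE (t : word n) : weight (wperm r^-1 t) = weight t.
  by rewrite -!weight_supp suppE card_imset //; exact: perm_inj.
have STSE z (A : {set 'I_n}) : A \in STS codeset z <->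
    exists t : word n, [/\ A = supp t, weight t = 3 & wadd t z \in codeset].
  split=> [/imsetP[x]|[t [-> wt Ct]]].
    rewrite inE hdistE => /andP[Cx /eqP wx] ->; exists (wadd x z).
    by rewrite waddK.
  apply/imsetP; exists (wadd t z); last by rewrite waddK.
  by rewrite inE Ct hdistE waddK wt eqxx.
apply/setP=> A; apply/imsetP/idP => [[B /STSE[t [-> wt Ct]] ->]|/STSE[t [-> wt]]].
  by apply/STSE; exists (wperm r^-1 t); rewrite suppE weightE wadd0 -CE.
rewrite wadd0 => Ct; pose t' := wperm r t.
have t'K : wperm r^-1 t' = t.
  by apply/ffunP=> i; rewrite !ffunE invgK permK.
exists (supp t'); last by rewrite -suppE t'K.
have wt' : weight t' = 3 by rewrite -weightE t'K.
by apply/STSE; exists t'; rewrite CE ?t'K.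
Qed.

(** Transitivity would give an automorphism taking zero to the codeword [y], along which a triad at
    [y] comes back to one at zero. *)
Lemma codeset_not_transitive y :
  C y -> odd_triad C y -> ~ odd_triad C (zerow I) -> ~ transitive_code codeset.
Proof.
move=> Cy triad_y no_triad0 tr; apply: no_triad0.
have yE : pullw f (pullw g y) = y by rewrite pullwK.
have Cy' : pullw g y \in codeset by rewrite inE yE.
have [r rE] := tr _ Cy'.
have memE (t : word n) : (t \in codeset) = (wadd (pullw g y) (wperm r t) \in codeset).
  rewrite -[in RHS]rE mem_imset => [|u v]; last first.
    by move=> /(congr1 (wadd (pullw g y))); rewrite !waddKl.
  rewrite mem_imset // => u v /ffunP e; apply/ffunP=> i.
  by have := e (r i); rewrite !ffunE permK.
have bij_g : bijective g by exists f.
have bij_r : bijective (r^-1)%g by exists r; [exact: permKV|exact: permK].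
have triadE z : odd_triad C z <-> odd_triad (fun x => x \in codeset) (pullw g z).
  apply: odd_triad_iso bij_g _ => t; rewrite inE -pullw_add.
  by rewrite (pullwK fK).
have shiftE (t : word n) : (addw t (pullw g (zerow I)) \in codeset) =
    (addw (pullw (r^-1)%g t) (pullw g y) \in codeset).
  have -> : addw t (pullw g (zerow I)) = t.
    by apply/ffunP=> i; rewrite !ffunE addbF.
  by rewrite memE addwC.
apply/triadE; have [_] := odd_triad_iso (C := [in codeset]) (D := [in codeset]) bij_r shiftE.
by apply; apply/triadE.
Qed.

End Transfer.

Theorem theorem5 (n : nat) :
  15 <= n -> (exists k : nat, n = (2 ^ k).-1) ->
  exists C : {set word n},
    [/\ zero_word n \in C, perfect C, homogeneous C & ~ transitive_code C].
Proof.
move=> n15 [k nE]; have k4 : 4 <= k.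
  by rewrite leqNgt; apply: contraL n15; rewrite nE; case: k {nE} => [|[|[|[|]]]].
have [I [C [cardI [C0 pC hC noC [y Cy triad_y]]]]] := good_code_exists k4.
move: cardI; rewrite -nE => cardI; pose f i := cast_ord cardI (enum_rank i).
pose g i := enum_val (cast_ord (esym cardI) i).
have fK : cancel f g by move=> i; rewrite /g /f cast_ordK enum_rankK.
have gK : cancel g f by move=> i; rewrite /g /f enum_valK cast_ordKV.
exists (codeset C f); split; last exact: (codeset_not_transitive fK gK Cy).
- rewrite inE; have -> : pullw f (zero_word n) = zerow I by apply/ffunP=> i; rewrite !ffunE.
  exact: C0.
- exact: codeset_perfect fK gK pC.
- exact: codeset_homogeneous fK gK hC.
Qed.
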